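(* For every integer $n\geq 0$, $$\overline{p}(16n+14)\equiv 0\pmod{16}.$$
   Context: An overpartition of a nonnegative integer $n$ is a partition of $n$ in which the first occurrence of each distinct part may be overlined. $\overline{p}(n)$ denotes the number of overpartitions of $n$ (with $\overline{p}(0)=1$); for example $\overline{p}(3)=8$. Its generating function is $\sum_{n\ge 0}\overline{p}(n)q^n=\prod_{m\ge 1}\frac{1+q^m}{1-q^m}$. *)

(* Defs.v *)
From mathcomp Require Import all_boot.

Set Implicit Arguments.
Unset Strict Implicit.
Unset Printing Implicit Defensive.

(* An overpartition is written as the non-increasing sequence of its parts;
   the entry (a, b) is the part a, overlined iff b = true. *)
Definition part_size (x : nat * bool) : nat := x.1.
Definition overlined (x : nat * bool) : bool := x.2.

(* y may directly follow x. As the parts are non-increasing, y is the first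
   occurrence of its part iff it is strictly smaller than its predecessor
   (the first entry of the sequence always is a first occurrence). *)
Definition may_follow (x y : nat * bool) : bool :=
  (part_size y <= part_size x) &&
  (overlined y ==> (part_size y < part_size x)).

Definition is_overpartition (n : nat) (s : seq (nat * bool)) : bool :=
  [&& sorted may_follow s,
      all (fun x => 0 < part_size x) s
    & sumn (map part_size s) == n].

Definition forget_bound (n : nat) (s : seq ('I_n.+1 * bool)) :
  seq (nat * bool) := [seq (val x.1, x.2) | x <- s].

(* An overpartition of n has at most n parts, each of size at most n, so that
   counting in this finite type loses nothing: see overpartitions_enum. *)
Definition num_overpartitions (n : nat) : nat :=
  #|[set s : {bseq n of 'I_n.+1 * bool} | is_overpartition n (forget_bound s)]|.

Lemma overpartition_bounded n s : is_overpartition n s ->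
  (size s <= n) && all (fun x => part_size x <= n) s.
Proof.
case/and3P=> _ + /eqP <-; elim: s => //= x s IHs /andP[x_gt0 /IHs/andP[szs les]].
rewrite leq_addr /= -add1n leq_add //=.
by apply: sub_all les => y /leq_trans; apply; rewrite leq_addl.
Qed.

Lemma forget_bound_inj n : injective (@forget_bound n).
Proof. by apply: inj_map => -[i b] [j c] [/val_inj -> ->]. Qed.

Lemma overpartitions_enum n (l : seq (seq (nat * bool))) :
  uniq l -> (forall s, (s \in l) = is_overpartition n s) ->
  num_overpartitions n = size l.
Proof.
move=> Ul meml; rewrite /num_overpartitions cardE.
rewrite -(size_map (fun s : {bseq n of _} => forget_bound s)).
apply/perm_size/uniq_perm => //.
  by rewrite map_inj_uniq ?enum_uniq // => s t /forget_bound_inj/val_inj.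
move=> s; rewrite meml; apply/mapP/idP => [[t + ->]|s_op].
  by rewrite mem_enum inE.
have /andP[szs les] := overpartition_bounded s_op.
pose t := [seq (inord x.1 : 'I_n.+1, x.2) | x <- s].
have szt : size t <= n by rewrite size_map.
have tK : forget_bound t = s.
  rewrite /forget_bound -map_comp -[RHS]map_id; apply/eq_in_map => -[a b].
  by move=> /(allP les) /= a_le; rewrite inordK.
by exists (Bseq szt); rewrite ?mem_enum ?inE /= tK.
Qed.

(* Main.v *)
Require Import Defs.
From mathcomp Require Import all_boot all_algebra.
From mathcomp Require Import ring zify.

Set Implicit Arguments.
Unset Strict Implicit.
Unset Printing Implicit Defensive.

Import GRing.Theory.

(** Let P(q) be the generating function of overpartitions. Gauss's identity
    says that 1 / P(q) = 1 + 2 S with S = sum_(j >= 1) (-1)^j q^(j^2), whence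
    P = 1 - 2 S + 4 S^2 - 8 S^3 + 16 S^4 P. Modulo 2 the square S^2 is the sum
    D of the squares of its terms, so modulo 16 the coefficient of q^N in P is
    that of 1 - 2 S + 4 S^2 - 8 D S. It can be nonzero only if N is 0 or of the
    form j^2, i^2 + j^2 or 2 i^2 + j^2 [overpartition_mod16], and the squares
    modulo 16 are 0, 1, 4, 9, so that 14 modulo 16 is never of such a form.

    The work is in Gauss's identity, obtained from a finite version
    [gauss_sumE]
      sum_(|j| <= n) (-1)^j q^(j^2) [2n, n+j]_q
        = (q; q)_(2n) / (q^2; q^2)_n,
    where [m, k]_q is the Gaussian binomial. The right-hand side gains the
    factor 1 - q^(2n+1) from n to n + 1. Multiplied by 1 - q^(2n+2), each term
    on the left gains this factor up to a difference H(j) - H(j+1), so that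
    the induction step is a telescoping sum [gauss_step]. Multiplied by
    (q; q)_n, the left-hand side agrees with 1 + 2 S up to degree n, because
    the weight q^(j^2) raises the precision n - j of
    [2n, n+j]_q (q; q)_n = 1 + O(q^(n-j+1)) to at least n [gbin_limit].

    The product formula for P comes from a recursion on the largest part: the
    generating function C_k of the sequences that may follow a part k satisfies
    (1 - q^(k+1)) C_(k+1) = (1 + q^k) C_k for k > 0 [follower_poly_step].
    As (q; q)_n (-q; q)_n = (q^2; q^2)_n, the two formulas combine to
    P (1 + 2 S) = 1 [overpartition_theta]. Power series are represented by
    polynomials modulo a power of X. *)

(** * Counting overpartitions by their largest part *)

(** These are the tails of overpartitions that may follow a part m, whether or
    not m is overlined, and have sum n. The parts that may come first are m
    without overline, m - 1 with an overline (if positive), or any part that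
    may also follow m - 1; after the first two cases the tail follows m or
    m - 1 respectively. Following a part, rather than being bounded by it,
    keeps the rule on overlined parts out of the recursion. *)
Fixpoint followers (m : nat) : nat -> seq (seq (nat * bool)) :=
  if m is k.+1 then
    fix followers_k n :=
      (if n is n'.+1 then
         if k <= n' then map (cons (k.+1, false)) (followers_k (n' - k))
         else [::]
       else [::])
      ++ (if 0 < k <= n then map (cons (k, true)) (followers k (n - k))
          else [::])
      ++ followers k n
  else fun n => if n is 0 then [:: [::]] else [::].

Arguments followers : simpl never.

Lemma followersS k n : followers k.+1 n =
  (if k < n then map (cons (k.+1, false)) (followers k.+1 (n - k.+1)) else [::])
  ++ (if 0 < k <= n then map (cons (k, true)) (followers k (n - k)) else [::])
  ++ followers k n.
Proof. by case: n. Qed.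

Lemma if_andb (p q : bool) : (if p then q else false) = p && q.
Proof. by case: p. Qed.

Lemma mem_map_cons (x : nat * bool) l y s :
  (y :: s \in map (cons x) l) = (y == x) && (s \in l).
Proof.
apply/mapP/andP => [[t lt [-> ->]] | [/eqP-> ls]]; first by [].
by exists s.
Qed.

Lemma nil_map_cons (x : nat * bool) l : ([::] \in map (cons x) l) = false.
Proof. by apply/negP => /mapP[]. Qed.

Definition is_follower (m n : nat) (s : seq (nat * bool)) : bool :=
  [&& path may_follow (m, true) s, all (fun x => 0 < part_size x) s
    & sumn (map part_size s) == n].

Lemma is_follower_cons m n a c s : is_follower m n ((a, c) :: s) =
  [&& 0 < a <= n, a <= m, c ==> (a < m) & is_follower a (n - a) s].
Proof.
rewrite /is_follower /= (_ : path _ (a, c) s = path may_follow (a, true) s).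
  rewrite {1}/may_follow /=.
  case: path; case: all; rewrite ?andbF //= ?andbT; lia.
by case: s.
Qed.

Lemma mem_followers m n s : (s \in followers m n) = is_follower m n s.
Proof.
elim: m n s => [|k IHk] n s.
  case: s => [|[a c] s]; first by case: n.
  by rewrite is_follower_cons; case: n a => [|n] [|a]; rewrite /= ?andbF.
elim/ltn_ind: n s => n IHn [|[a c] s]; rewrite followersS !mem_cat.
  rewrite -[RHS](IHk n [::]) 2!(fun_if (fun l : seq _ => _ \in l)).
  by rewrite !nil_map_cons !in_nil !if_same.
rewrite !IHk 2!(fun_if (fun l : seq _ => _ \in l)) !mem_map_cons !in_nil !IHk.
rewrite !is_follower_cons !xpair_eqE !if_andb.
have -> : [&& k < n, (a == k.+1) && (c == false)
      & s \in followers k.+1 (n - k.+1)] =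
    [&& k < n, (a == k.+1) && (c == false) & is_follower k.+1 (n - k.+1) s].
  by case: ltnP => //= kn; rewrite IHn //; lia.
have [->|ak1] := eqVneq a k.+1; first by case: c; case: is_follower; lia.
have [->|ak] := eqVneq a k; first by case: c; case: is_follower; lia.
by case: c; case: is_follower; lia.
Qed.

Lemma followers_uniq m n : uniq (followers m n).
Proof.
elim: m n => [|k IHk] n; first by case: n.
elim/ltn_ind: n => n IHn; rewrite followersS !cat_uniq IHk andbT.
have cons_inj (x : nat * bool) : injective (cons x) by move=> s t [].
apply/and4P; split.
- by case: ltnP => // kn; rewrite map_inj_uniq // IHn //; lia.
- rewrite has_cat negb_or; apply/andP; split.
    case: (0 < k <= n) => //; apply/hasPn => _ /mapP[s _ ->] /=.
    by case: ifP => // _; rewrite mem_map_cons xpair_eqE; lia.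
  case: ifP => [_|_]; last by rewrite has_pred0.
  apply/hasPn => s; rewrite mem_followers; case: s => [|[a c] s].
    by rewrite nil_map_cons.
  by rewrite is_follower_cons mem_map_cons xpair_eqE; lia.
- by case: ifP => // _; rewrite map_inj_uniq.
case: ifP => [_|_]; last by rewrite has_pred0.
apply/hasPn => s; rewrite mem_followers; case: s => [|[a c] s].
  by rewrite nil_map_cons.
by rewrite is_follower_cons mem_map_cons xpair_eqE; lia.
Qed.

(** No part of an overpartition of n exceeds n, so that a fictitious first part
    m > n restricts neither the parts nor their overlines. *)
Lemma num_overpartitionsE m n :
  n < m -> num_overpartitions n = size (followers m n).
Proof.
move=> nm; apply: overpartitions_enum; first exact: followers_uniq.
move=> s; rewrite mem_followers /is_follower.
apply/idP/idP => [/and3P[/path_sorted sorted_s s_gt0 sum_s]|ovs].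
  exact/and3P.
have /andP[_ les] := overpartition_bounded ovs.
have /and3P[sorted_s s_gt0 sum_s] := ovs; apply/and3P; split=> //.
case: s sorted_s les {ovs s_gt0 sum_s} => //= -[a c] s -> /andP[/= an _].
by rewrite /may_follow /part_size /= andbT in an *; lia.
Qed.

Lemma size_followers k n : size (followers k.+1 n) =
  (if k < n then size (followers k.+1 (n - k.+1)) else 0) +
  (if 0 < k <= n then size (followers k (n - k)) else 0) + size (followers k n).
Proof.
by rewrite followersS !size_cat !(fun_if size) !size_map addnA.
Qed.

Local Open Scope ring_scope.

(** * Polynomials modulo a power of the variable *)

Definition eqXn (R : comNzRingType) n (p q : {poly R}) : Prop :=
  exists r, p = q + r * 'X^n.

Lemma eqXn_refl (R : comNzRingType) n (p : {poly R}) : eqXn n p p.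
Proof. by exists 0; ring. Qed.

Lemma eqXn_sym (R : comNzRingType) n (p q : {poly R}) :
  eqXn n p q -> eqXn n q p.
Proof. by case=> r ->; exists (- r); ring. Qed.

Lemma eqXn_trans (R : comNzRingType) n (q p s : {poly R}) :
  eqXn n p q -> eqXn n q s -> eqXn n p s.
Proof. by case=> r -> [t ->]; exists (r + t); ring. Qed.

Lemma eqXnD (R : comNzRingType) n (p q s t : {poly R}) :
  eqXn n p q -> eqXn n s t -> eqXn n (p + s) (q + t).
Proof. by case=> r -> [u ->]; exists (r + u); ring. Qed.

Lemma eqXnM (R : comNzRingType) n (p q s t : {poly R}) :
  eqXn n p q -> eqXn n s t -> eqXn n (p * s) (q * t).
Proof. by case=> r -> [u ->]; exists (r * t + q * u + r * u * 'X^n); ring. Qed.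

Lemma eqXn_weaken (R : comNzRingType) m n (p q : {poly R}) :
  (m <= n)%N -> eqXn n p q -> eqXn m p q.
Proof.
by move=> mn [r ->]; exists (r * 'X^(n - m)); rewrite -mulrA -exprD subnK.
Qed.

Lemma eqXn_mulXn (R : comNzRingType) k n (p q : {poly R}) :
  eqXn n p q -> eqXn (k + n) ('X^k * p) ('X^k * q).
Proof. by case=> r ->; exists r; rewrite exprD; ring. Qed.

Lemma eqXn_coef (R : comNzRingType) n (p q : {poly R}) :
  (forall i, (i < n)%N -> p`_i = q`_i) -> eqXn n p q.
Proof.
move=> eq_pq; exists (drop_poly n (p - q)).
rewrite -[LHS](subrK q) addrC -{1}(poly_take_drop n (p - q)).
rewrite [take_poly _ _](_ : _ = 0) ?add0r //.
apply/polyP => i; rewrite coef_take_poly coef0 coefB.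
by case: ltnP => // /eq_pq ->; rewrite subrr.
Qed.

(** As 1 - c = e X for some e, the truncated geometric series in 1 - c inverts c
    up to (1 - c)^n = e^n X^n. *)
Lemma eqXn_inv (R : comNzRingType) n (c : {poly R}) :
  c`_0 = 1 -> exists d, eqXn n (d * c) 1.
Proof.
move=> c0; have [e def_e] : eqXn 1 (1 - c) 0.
  by apply: eqXn_coef => -[|//] _; rewrite coefB c0 coef1 subrr coef0.
exists (\sum_(i < n) (1 - c) ^+ i); exists (- e ^+ n).
have: c = - ((1 - c) - 1) by ring.
move: (1 - c) def_e => x def_e ->.
rewrite mulrN mulrC -subrX1 def_e add0r exprMn -exprM mul1n; ring.
Qed.

Lemma eqXn_cancel (R : comNzRingType) n (c p q : {poly R}) :
  c`_0 = 1 -> eqXn n (c * p) (c * q) -> eqXn n p q.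
Proof.
move=> /(eqXn_inv n)[d dc] cpq.
have dcK s : eqXn n (d * (c * s)) s.
  by rewrite mulrA -[X in eqXn _ _ X]mul1r; apply/eqXnM/eqXn_refl.
apply: eqXn_trans (dcK q); apply: eqXn_trans (eqXn_sym (dcK p)) _.
exact/eqXnM/cpq/eqXn_refl.
Qed.

(** * Gaussian binomial coefficients *)

(** The Gaussian binomial coefficient [m, k] in the variable 'X. *)
Fixpoint gbin (R : comNzRingType) (m k : nat) : {poly R} :=
  match m, k with
  | _, 0 => 1
  | 0, _.+1 => 0
  | m'.+1, k'.+1 => gbin R m' k' + 'X^k * gbin R m' k
  end.

Lemma gbin0 (R : comNzRingType) m : gbin R m 0 = 1.
Proof. by case: m. Qed.

Lemma gbinS (R : comNzRingType) m k :
  gbin R m.+1 k.+1 = gbin R m k + 'X^(k.+1) * gbin R m k.+1.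
Proof. by []. Qed.

Arguments gbin : simpl never.

Lemma gbin_small (R : comNzRingType) m k : (m < k)%N -> gbin R m k = 0.
Proof.
elim: m k => [|m IHm] [|k] // mk.
by rewrite gbinS !IHm ?mulr0 ?addr0 // ltnW.
Qed.

Lemma polyXn_split (R : comNzRingType) m k : (k <= m)%N ->
  'X^(m.+1) = 'X^(k.+1) * 'X^(m - k) :> {poly R}.
Proof. by move=> km; rewrite -exprD addSn subnKC. Qed.

(** The Pascal rule turns one of the two absorption laws at m into the other.
    Both hold unconditionally ([gbin_next] and [gbin_upper_lower]), but the
    induction on m that proves the first needs the second on its way. *)
Lemma gbin_absorb (R : comNzRingType) m k : (k <= m)%N ->
  (1 - 'X^(k.+1)) * gbin R m k.+1 = (1 - 'X^(m - k)) * gbin R m k ->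
  (1 - 'X^(k.+1)) * gbin R m.+1 k.+1 = (1 - 'X^(m.+1)) * gbin R m k.
Proof.
move=> km next; rewrite gbinS mulrDr mulrCA next (polyXn_split R km).
by ring.
Qed.

Lemma gbin_next (R : comNzRingType) m k : (k <= m)%N ->
  (1 - 'X^(k.+1)) * gbin R m k.+1 = (1 - 'X^(m - k)) * gbin R m k.
Proof.
elim: m k => [|m IHm] k.
  by case: k => // _; rewrite subnn /= subrr mul0r mulr0.
rewrite leq_eqVlt => /predU1P[->|km].
  by rewrite subnn subrr mul0r gbin_small ?mulr0.
rewrite gbin_absorb ?IHm //.
case: k km => [|k] km; first by rewrite subn0 !gbin0.
rewrite gbinS mulrDr subSS -IHm 1?ltnW // (@polyXn_split R m k) 1?ltnW //.
by ring.
Qed.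

Lemma gbin_upper_lower (R : comNzRingType) m k : (k <= m)%N ->
  (1 - 'X^(k.+1)) * gbin R m.+1 k.+1 = (1 - 'X^(m.+1)) * gbin R m k.
Proof. by move=> km; apply/gbin_absorb/gbin_next. Qed.

Lemma gbin_upper (R : comNzRingType) m k : (k <= m.+1)%N ->
  (1 - 'X^(m.+1 - k)) * gbin R m.+1 k = (1 - 'X^(m.+1)) * gbin R m k.
Proof.
rewrite leq_eqVlt => /predU1P[->|km].
  by rewrite subnn subrr mul0r gbin_small ?mulr0.
by rewrite -gbin_next 1?ltnW // gbin_upper_lower.
Qed.

Definition qfact (R : comNzRingType) n : {poly R} :=
  \prod_(i < n) (1 - 'X^(i.+1)).

Lemma qfactS (R : comNzRingType) n :
  qfact R n.+1 = qfact R n * (1 - 'X^(n.+1)).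
Proof. by rewrite /qfact big_ord_recr. Qed.

Lemma gbin_qfact (R : comNzRingType) m k : (k <= m)%N ->
  gbin R m k * qfact R k * qfact R (m - k) = qfact R m.
Proof.
elim: m k => [|m IHm] [|k] // km; rewrite ?gbin0 /qfact ?big_ord0 ?mul1r //.
rewrite -!/(qfact R _) subSS !qfactS -(IHm k) //.
transitivity ((1 - 'X^(k.+1)) * gbin R m.+1 k.+1 * qfact R k * qfact R (m - k)).
  by ring.
by rewrite gbin_upper_lower //; ring.
Qed.

(** * The finite form of Gauss's identity *)

(** The sum over |j| <= n of (-1)^j 'X^(j^2) [2n, n+j]; the terms j and - j are
    equal, and folding them avoids negative indices. *)
Definition gauss_sum (R : comNzRingType) n : {poly R} :=
  gbin R n.*2 n +
  2%:R * \sum_(1 <= j < n.+1) (-1) ^+ j * 'X^(j ^ 2) * gbin R n.*2 (n + j).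

(** The certificate H(j) of the telescoping, found from
      (1 - q^(2n)) - (1 - q^(n-j)) (1 - q^(n+j))
        = q^(n-j) (1 - q^(n+j)) + q^(n+j) (1 - q^(n-j)):
    times (-1)^j q^(j^2) [2n, n+j], the first summand on the right is H(j) and
    the second is - H(j+1). *)
Definition gauss_tele (R : comNzRingType) n j : {poly R} :=
  (-1) ^+ j * 'X^(j * j.-1 + n) * ((1 - 'X^(n + j)) * gbin R n.*2 (n + j)).

(** The ratio [2n+2, n+1+j] / [2n, n+j], obtained by lowering the upper index
    alone and then both indices; at j = n + 1 both sides vanish. *)
Lemma gbin_two_steps (R : comNzRingType) n j : (j <= n.+1)%N ->
  (1 - 'X^(n.+1.*2)) * (1 - 'X^(n.*2.+1)) * gbin R n.*2 (n + j) =
  (1 - 'X^(n.+1 + j)) * (1 - 'X^(n.+1 - j)) * gbin R n.+1.*2 (n.+1 + j).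
Proof.
move=> jn; rewrite doubleS -mulrA -gbin_upper; last by lia.
rewrite mulrCA -gbin_upper_lower; last by lia.
rewrite (_ : (_ - (n + j) = n.+1 - j)%N); last by lia.
by rewrite addSn; ring.
Qed.

Lemma gauss_step (R : comNzRingType) n j : (0 < j <= n.+1)%N ->
  (1 - 'X^(n.+1.*2)) * ((-1) ^+ j * 'X^(j ^ 2) * gbin R n.+1.*2 (n.+1 + j)) -
  (1 - 'X^(n.+1.*2)) * (1 - 'X^(n.*2.+1)) *
    ((-1) ^+ j * 'X^(j ^ 2) * gbin R n.*2 (n + j)) =
  - (gauss_tele R n.+1 j.+1 - gauss_tele R n.+1 j).
Proof.
case: j => // j /andP[_ jn]; rewrite /gauss_tele.
have -> : (-1) ^+ j.+2 = - (-1) ^+ j.+1 :> {poly R} by rewrite exprS mulN1r.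
set e := (-1) ^+ _.
rewrite [(n.+1 + j.+2)%N]addnS gbin_next; last by lia.
have two := @gbin_two_steps R n j.+1 jn.
(* Both Gaussian binomials become multiples of the one of index 2n + 2. *)
have -> : forall x u v g : {poly R}, u * v * (x * g) = x * (u * v * g).
  by move=> *; ring.
rewrite two (_ : (n.+1.*2 - (n.+1 + j.+1) = n.+1 - j.+1)%N); last by lia.
rewrite -[j.+1.-1]/j -[j.+2.-1]/j.+1.
have -> : 'X^(n.+1.*2) = 'X^(n.+1 + j.+1) * 'X^(n.+1 - j.+1) :> {poly R}.
  by rewrite -exprD; congr ('X^_); lia.
have -> : 'X^(j.+2 * j.+1 + n.+1) = 'X^(j.+1 ^ 2) * 'X^(n.+1 + j.+1) :> {poly R}.
  by rewrite -exprD; congr ('X^_); lia.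
have -> : 'X^(j.+1 * j + n.+1) = 'X^(j.+1 ^ 2) * 'X^(n.+1 - j.+1) :> {poly R}.
  by rewrite -exprD; congr ('X^_); lia.
by ring.
Qed.

(** The differences H(j) - H(j+1) add up over j >= 1 to H(1), as H(n+2) = 0.
    Taken twice, this cancels the discrepancy of the central term j = 0, which
    is H(0) - H(1) = - 2 H(1). The factor 1 - 'X^(2n+2) stays on both sides, so
    that nothing has to be cancelled. *)
Lemma gauss_sum_step (R : comNzRingType) n :
  (1 - 'X^(n.+1.*2)) * gauss_sum R n.+1 =
  (1 - 'X^(n.+1.*2)) * (1 - 'X^(n.*2.+1)) * gauss_sum R n.
Proof.
(* The added term j = n + 1 is zero; both sums now have the same range. *)
have -> : gauss_sum R n = gbin R n.*2 n +
    2%:R * \sum_(1 <= j < n.+2) (-1) ^+ j * 'X^(j ^ 2) * gbin R n.*2 (n + j).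
  rewrite big_nat_recr //= [gbin _ _ (n + n.+1)]gbin_small; last by lia.
  by rewrite mulr0 addr0.
have sum_step : (1 - 'X^(n.+1.*2)) *
      (\sum_(1 <= j < n.+2) (-1) ^+ j * 'X^(j ^ 2) * gbin R n.+1.*2 (n.+1 + j)) -
    (1 - 'X^(n.+1.*2)) * (1 - 'X^(n.*2.+1)) *
      (\sum_(1 <= j < n.+2) (-1) ^+ j * 'X^(j ^ 2) * gbin R n.*2 (n + j)) =
    - ('X^(n.+1) * ((1 - 'X^(n.+1)) * gbin R n.+1.*2 n.+1)).
  rewrite !mulr_sumr -sumrB.
  rewrite (eq_big_nat _ _ (F2 := fun j =>
    - (gauss_tele R n.+1 j.+1 - gauss_tele R n.+1 j))); last first.
    by move=> j jn; rewrite -gauss_step.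
  rewrite sumrN telescope_sumr // opprB.
  rewrite /gauss_tele [gbin _ _ (n.+1 + n.+2)]gbin_small; last by lia.
  rewrite !mulr0 subr0 addn1 gbin_next; last by lia.
  rewrite (_ : (n.+1.*2 - n.+1 = n.+1)%N); last by lia.
  by rewrite mulN1r mulNr.
have two := @gbin_two_steps R n 0 isT; rewrite !addn0 subn0 in two.
apply/eqP; rewrite -subr_eq0 /gauss_sum; apply/eqP.
set S1 := \sum_(_ <= _ < _) _ in sum_step *.
set S0 := \sum_(_ <= _ < _) _ in sum_step *.
transitivity ((1 - 'X^(n.+1.*2)) * gbin R n.+1.*2 n.+1 -
  (1 - 'X^(n.+1.*2)) * (1 - 'X^(n.*2.+1)) * gbin R n.*2 n
  + 2%:R * ((1 - 'X^(n.+1.*2)) * S1 -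
            (1 - 'X^(n.+1.*2)) * (1 - 'X^(n.*2.+1)) * S0)).
  by ring.
rewrite sum_step two -addnn exprD.
by ring.
Qed.

Lemma gauss_sumE (R : comNzRingType) n :
  gauss_sum R n * \prod_(i < n) (1 - 'X^(i.+1.*2)) = qfact R n.*2.
Proof.
elim: n => [|n IHn].
  by rewrite /gauss_sum /qfact !big_ord0 big_geq //= mulr0 addr0 mulr1.
rewrite big_ord_recr /= doubleS !qfactS -IHn -doubleS.
set P := \prod_(_ < _) _.
transitivity ((1 - 'X^(n.+1.*2)) * gauss_sum R n.+1 * P); first by ring.
by rewrite gauss_sum_step; ring.
Qed.

(** * The limit of the finite form *)

Lemma qfact_coef0 (R : comNzRingType) n : (qfact R n)`_0 = 1.
Proof.
elim: n => [|n IHn]; first by rewrite /qfact big_ord0 coef1.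
by rewrite qfactS coef0M IHn coefB coef1 coefXn subr0 mulr1.
Qed.

Lemma qfact_stable (R : comNzRingType) m n :
  (m <= n)%N -> eqXn m.+1 (qfact R n) (qfact R m).
Proof.
move=> /subnK <-; elim: (n - m)%N => [|d IHd]; first exact: eqXn_refl.
rewrite addSn qfactS -[X in eqXn _ _ X]mulr1; apply: eqXnM => //.
apply: (@eqXn_weaken _ _ (d + m).+1); first by rewrite ltnS leq_addl.
by exists (-1); ring.
Qed.

(** Modulo 'X^(n-j+1) the factorials of n - j, n, n + j and 2n coincide, so that
    [2n, n+j] times this factorial is 1. The factor 'X^(j^2) raises the
    precision to j^2 + n - j + 1, which is at least n + 1. *)
Lemma gbin_limit (R : comNzRingType) n j : (j <= n)%N ->
  eqXn n.+1 ('X^(j ^ 2) * (gbin R n.*2 (n + j) * qfact R n)) 'X^(j ^ 2).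
Proof.
move=> jn; rewrite -[X in eqXn _ _ X]mulr1.
apply: (@eqXn_weaken _ _ (j ^ 2 + (n - j).+1)); first by case: j jn; lia.
apply: eqXn_mulXn; apply: (@eqXn_cancel _ _ (qfact R (n - j))).
  exact: qfact_coef0.
have n2 : (n.*2 - (n + j) = n - j)%N by lia.
apply: (@eqXn_trans _ _ (qfact R n.*2)); last first.
  by rewrite mulr1; apply: qfact_stable; lia.
rewrite -(@gbin_qfact R n.*2 (n + j)) ?n2; last by lia.
rewrite mulrC; apply: eqXnM; last exact: eqXn_refl.
apply: eqXnM; first exact: eqXn_refl.
apply: (@eqXn_trans _ _ (qfact R (n - j))); last apply: eqXn_sym;
  by apply: qfact_stable; lia.
Qed.

(** The part j > 0 of the theta series, which is 1 + 2 theta_half. *)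
Definition theta_half (R : comNzRingType) n : {poly R} :=
  \sum_(1 <= j < n.+1) (-1) ^+ j * 'X^(j ^ 2).

Lemma gauss_sum_limit (R : comNzRingType) n :
  eqXn n.+1 (gauss_sum R n * qfact R n) (1 + 2%:R * theta_half R n).
Proof.
rewrite /gauss_sum mulrDl; apply: eqXnD.
  by have := @gbin_limit R n 0 isT; rewrite addn0 mul1r.
rewrite -mulrA; apply: eqXnM; first exact: eqXn_refl.
rewrite /theta_half mulr_suml !big_seq.
apply: (big_ind2 (eqXn n.+1)).
- exact: eqXn_refl.
- by move=> *; apply: eqXnD.
move=> j; rewrite mem_index_iota => jn.
rewrite -!mulrA; apply: eqXnM; first exact: eqXn_refl.
by apply: gbin_limit; lia.
Qed.

(** * The generating function of overpartitions *)

Definition follower_poly m M : {poly int} :=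
  \poly_(i < M) (size (followers m i))%:R.

(** The three ways to continue after a part k + 1 give
    C_(k+1) = 'X^(k+1) C_(k+1) + 'X^k C_k + C_k, where the middle term is absent
    for k = 0 because parts are positive. *)
Lemma follower_poly_step k M :
  eqXn M ((1 - 'X^(k.+1)) * follower_poly k.+1 M)
         ((if k is 0 then 1 else 1 + 'X^k) * follower_poly k M).
Proof.
apply: eqXn_coef => i iM.
transitivity ((size (followers k.+1 i))%:R -
    (if (k < i)%N then (size (followers k.+1 (i - k.+1)))%:R else 0) : int).
  rewrite mulrBl mul1r coefB coefXnM !coef_poly iM ltnNge; case: leqP => // ki.
  by rewrite (leq_ltn_trans (leq_subr _ _) iM).
transitivity ((size (followers k i))%:R +
    (if (0 < k <= i)%N then (size (followers k (i - k)))%:R else 0) : int).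
  by rewrite size_followers; do 2!case: ifP => _;
    rewrite ?(natrD, addr0, add0r); ring.
case: k => [|k]; first by rewrite mul1r coef_poly iM addr0.
rewrite mulrDl mul1r coefD coefXnM !coef_poly iM.
rewrite ltn0Sn (leqNgt k.+1); case: ltnP => //= ki.
by rewrite (leq_ltn_trans (leq_subr _ _) iM).
Qed.

Lemma follower_poly_qfact k M :
  eqXn M (qfact int k.+1 * follower_poly k.+1 M)
         (\prod_(i < k) (1 + 'X^(i.+1))).
Proof.
elim: k => [|k IHk].
  rewrite big_ord0 /qfact big_ord1; apply: eqXn_trans (follower_poly_step 0 M) _.
  by apply: eqXn_coef => -[|i] iM; rewrite mul1r coef_poly iM coef1.
rewrite qfactS -mulrA big_ord_recr /=.
apply: eqXn_trans (eqXnM (eqXn_refl _ _) (follower_poly_step _ _)) _.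
by rewrite mulrCA mulrC; apply: eqXnM IHk (eqXn_refl _ _).
Qed.

(** With P = (1 + 'X) ... (1 + 'X^n), the product formula says that
    (q; q)_n G = P, and (q; q)_n P = (q^2; q^2)_n turns the finite Gauss identity
    into gauss_sum (q; q)_n P = (q; q)_(2n), which is (q; q)_n to this
    precision. Hence (q; q)_n G (1 + 2 theta_half) = (q; q)_n. *)
Lemma overpartition_theta n :
  eqXn n.+1 (follower_poly n.+1 n.+1 * (1 + 2%:R * theta_half int n)) 1.
Proof.
set G := follower_poly _ _.
pose P : {poly int} := \prod_(i < n) (1 + 'X^(i.+1)).
have GP : eqXn n.+1 (qfact int n * G) P.
  apply: eqXn_trans (follower_poly_qfact n n.+1).
  apply/eqXnM/eqXn_refl/eqXn_sym/qfact_stable/leqnSn.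
have sumP : gauss_sum int n * (qfact int n * P) = qfact int n.*2.
  rewrite -gauss_sumE /P /qfact -big_split /=; congr (_ * _).
  by apply: eq_bigr => i _; rewrite -addnn exprD; ring.
apply: (eqXn_cancel (qfact_coef0 int n)); rewrite mulr1.
apply: (@eqXn_trans _ _ (gauss_sum int n * (qfact int n * P))); last first.
  by rewrite sumP; apply: qfact_stable; lia.
apply: (@eqXn_trans _ _ (qfact int n * G * (gauss_sum int n * qfact int n))).
  rewrite [X in eqXn _ X _]mulrA; apply: eqXnM; first exact: eqXn_refl.
  exact/eqXn_sym/gauss_sum_limit.
rewrite [X in eqXn _ X _]mulrC -mulrA.
by apply: eqXnM (eqXn_refl _ _) (eqXnM (eqXn_refl _ _) GP).
Qed.

(** * Reduction modulo 16 *)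

(** The squaring map is additive modulo 2. *)
Lemma sum_sqr (R : comNzRingType) (I : Type) (r : seq I) (F : I -> R) :
  exists e, (\sum_(i <- r) F i) ^+ 2 = \sum_(i <- r) F i ^+ 2 + 2%:R * e.
Proof.
elim: r => [|i r [e IHr]]; first by exists 0; rewrite !big_nil; ring.
exists (e + F i * \sum_(j <- r) F j).
by rewrite !big_cons sqrrD IHr; ring.
Qed.

Lemma coef_signX (R : comNzRingType) k m N :
  N != m -> ((-1) ^+ k * 'X^m : {poly R})`_N = 0.
Proof.
move=> /negPf Nm; rewrite -signr_odd; case: odd.
  by rewrite mulN1r coefN coefXn Nm oppr0.
by rewrite mul1r coefXn Nm.
Qed.

(** Expand the inverse of 1 + 2 S up to S^3. In 8 S^3 the square S^2 only matters
    modulo 2, where it is the sum D of the squared terms of S. *)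
Lemma overpartition_mod16 N : (0 < N)%N ->
  (forall j, (j ^ 2 != N)%N) ->
  (forall i j, (i ^ 2 + j ^ 2 != N)%N) ->
  (forall i j, (2 * i ^ 2 + j ^ 2 != N)%N) ->
  (16 %| num_overpartitions N)%N.
Proof.
move=> N_gt0 no1 no2 no21.
have [r GS] := overpartition_theta N.
set G := follower_poly _ _ in GS; set S := theta_half _ _ in GS.
pose D : {poly int} := \sum_(1 <= i < N.+1) ((-1) ^+ i * 'X^(i ^ 2)) ^+ 2.
have [E S2] : exists E, S ^+ 2 = D + 2%:R * E by apply: sum_sqr.
have GE : G = 1 + (-1) * (2%:R * S) + 4%:R * S ^+ 2 + (-1) * (8%:R * (D * S))
  + 16%:R * (S ^+ 4 * G - E * S)
  + (1 - 2%:R * S + 4%:R * S ^+ 2 - 8%:R * S ^+ 3) * r * 'X^(N.+1).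
  transitivity ((1 - 2%:R * S + 4%:R * S ^+ 2 - 8%:R * S ^+ 3) *
     (G * (1 + 2%:R * S)) + 16%:R * S ^+ 4 * G); first by ring.
  rewrite GS (_ : S ^+ 3 = (D + 2%:R * E) * S); last by rewrite -S2; ring.
  by ring.
have S_N : S`_N = 0.
  by rewrite coef_sum big1 // => j _; rewrite coef_signX // eq_sym.
have S2_N : (S ^+ 2)`_N = 0.
  rewrite expr2 mulr_suml coef_sum big1 // => i _.
  rewrite mulr_sumr coef_sum big1 // => j _.
  by rewrite mulrACA -!exprD coef_signX // eq_sym.
have DS_N : (D * S)`_N = 0.
  rewrite mulr_suml coef_sum big1 // => i _.
  rewrite mulr_sumr coef_sum big1 // => j _.
  rewrite exprMn sqrr_sign mul1r -exprM mulrCA -exprD mulnC.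
  by rewrite coef_signX // eq_sym.
have G_N : G`_N = (num_overpartitions N)%:R.
  by rewrite coef_poly ltnSn -num_overpartitionsE.
have := congr1 (fun p : {poly int} => p`_N) GE.
rewrite G_N !mulr_natl !mulN1r !(coefD, coefN, coefMn) S_N S2_N DS_N coefMXn.
rewrite ltnSn.
rewrite coef1 (gtn_eqF N_gt0) !(mul0rn, oppr0, addr0, add0r).
by move: _`_N => x; lia.
Qed.

Lemma sqr_modn16 a : (a ^ 2 %% 16 \in [:: 0; 1; 4; 9])%N.
Proof.
rewrite -modnXm; have := ltn_pmod a (isT : (0 < 16)%N).
by move: (a %% 16)%N; do 16!case=> //.
Qed.

Lemma sum_two_squares_mod16 n a b : (a ^ 2 + b ^ 2 != 16 * n + 14)%N.
Proof. by have := sqr_modn16 a; have := sqr_modn16 b; rewrite !inE; lia. Qed.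

Lemma sum_twice_square_square_mod16 n a b :
  (2 * a ^ 2 + b ^ 2 != 16 * n + 14)%N.
Proof. by have := sqr_modn16 a; have := sqr_modn16 b; rewrite !inE; lia. Qed.

Local Close Scope ring_scope.

Theorem theorem1p1 (n : nat) :
  num_overpartitions (16 * n + 14) = 0 %[mod 16].
Proof.
apply/eqP; rewrite mod0n; apply: overpartition_mod16; first by rewrite addnS.
- by move=> j; have := sum_two_squares_mod16 n j 0; rewrite addn0.
- exact: sum_two_squares_mod16.
exact: sum_twice_square_square_mod16.
Qed.
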